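(* Let $n$ be a positive integer. Let $\mathcal{REL}_{n+1}$ be the space of relations between the degree $n+1$ invariants of the conjugation action of the complex orthogonal group $O_n$ on $\mathcal{P}(M_n)$, i.e. the kernel of the surjective linear restriction map $$\mathcal{P}^{n+1}(M_{n+1})^{O_{n+1}} \twoheadrightarrow \mathcal{P}^{n+1}(M_n)^{O_n}.$$ Then $$\dim_{\mathbb{C}}(\mathcal{REL}_{n+1}) = \begin{cases} \dfrac{n}{2}+1 & \text{if } n \text{ is even},\\[2mm] \dfrac{n+3}{2} & \text{if } n \text{ is odd}.\end{cases}$$
   Context: For a positive integer $m$, $M_m$ denotes the space of $m\times m$ complex matrices, $O_m=\{g\in GL_m(\mathbb{C}) : g^Tg=I\}$ is the complex orthogonal group, $\mathcal{P}(M_m)$ is the $\mathbb{C}$-algebra of polynomial functions on $M_m$, and $\mathcal{P}^d(M_m)$ is its subspace of homogeneous polynomials of degree $d$. The group $O_m$ acts on $\mathcal{P}(M_m)$, preserving each $\mathcal{P}^d(M_m)$, by conjugation: $(g\cdot f)(x)=f(g^Txg)$ for $g\in O_m$, $f\in\mathcal{P}(M_m)$, $x\in M_m$. The space of invariants in degree $d$ is denoted $\mathcal{P}^d(M_m)^{O_m}$. Restriction map: embed $M_n\hookrightarrow M_{n+1}$ by $x\mapsto \begin{pmatrix} x & 0\\ 0 & 0\end{pmatrix}$. Restricting polynomial functions along this embedding gives a map $\mathcal{P}(M_{n+1})\to\mathcal{P}(M_n)$, which restricts to a surjective linear map $\mathcal{P}^{n+1}(M_{n+1})^{O_{n+1}}\to\mathcal{P}^{n+1}(M_n)^{O_n}$.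 The space $\mathcal{REL}_{n+1}$ is the kernel of this map. Equivalently, using $M_m\simeq\mathbb{C}^m\otimes\mathbb{C}^m$ as $O_m$-representations (and the self-duality of $\mathbb{C}^m$ under $O_m$) and identifying $\mathcal{P}^{n+1}(M_m)$ with the symmetric tensors in $\otimes^{n+1}M_m$, $\mathcal{REL}_{n+1}$ is the kernel of the corresponding surjection $$\zeta:[\otimes^{2(n+1)}\mathbb{C}^{n+1}]^{O_{n+1}\times\Delta S_{n+1}}\twoheadrightarrow[\otimes^{2(n+1)}\mathbb{C}^{n}]^{O_{n}\times\Delta S_{n+1}},$$ where $\Delta S_{n+1}=\{(\sigma,\sigma):\sigma\in S_{n+1}\}\subseteq S_{n+1}\times S_{n+1}\subseteq S_{2(n+1)}$ is the diagonally embedded symmetric group, acting by permuting the $n+1$ tensor factors $M_m\simeq\mathbb{C}^m\otimes\mathbb{C}^m$. *)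

(* Defs.v *)
From HB Require Import structures.
From mathcomp Require Import all_boot all_order all_algebra.
From mathcomp Require Import complex reals.
From mathcomp Require Import mpoly.

Set Implicit Arguments.
Unset Strict Implicit.
Unset Printing Implicit Defensive.

Import GRing.Theory.
Local Open Scope ring_scope.

(* The algebra P(M_m) of polynomial functions on m x m matrices (over an
   infinite field K) is represented by {mpoly K[m * m]}, the variable of index
   mxvec_index i j being the (i, j) coordinate function.
   The actual functions are recovered by mxeval; the lemmas conj_actE and
   restrE below identify conj_act and restr with the precomposition by
   x |-> g^T x g and by x |-> block_mx x 0 0 0 respectively. *)

(* P^d(M_m); the library makes dhomog k K d a vectType only when k is
   syntactically a successor, whence the restriction to m.+1 below. *)
Definition hpolyfun (K : fieldType) (m d : nat) : Type := dhomog (m * m) K d.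

HB.instance Definition _ (K : fieldType) (m d : nat) :=
  GRing.Lmodule.copy (hpolyfun K m d) (dhomog (m * m) K d).
HB.instance Definition _ (K : fieldType) (n d : nat) :=
  Vector.copy (hpolyfun K n.+1 d) (dhomog (n + n * n.+1).+1 K d).

Definition polyfun_of (K : fieldType) (m d : nat) (f : hpolyfun K m d) :
  {mpoly K[m * m]} := mpoly_of_dhomog f.

Lemma polyfun_of_is_linear (K : fieldType) (m d : nat) :
  linear (@polyfun_of K m d).
Proof. exact: mpoly_of_dhomog_is_linear. Qed.

Section PolynomialFunctions.
Variable K : fieldType.

Definition mxeval m (f : {mpoly K[m * m]}) (x : 'M[K]_m) : K :=
  f.@[fun k => mxvec x 0 k].

Definition coord_mx m : 'M[{mpoly K[m * m]}]_m :=
  \matrix_(i, j) 'X_(mxvec_index i j).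

Definition mxsubst m k (f : {mpoly K[m * m]}) (A : 'M[{mpoly K[k]}]_m) :
    {mpoly K[k]} :=
  f \mPo [tuple mxvec A 0 l | l < m * m].

Definition orthogonal_mx m (g : 'M[K]_m) : Prop := g^T *m g = 1%:M.

Definition conj_act m (g : 'M[K]_m) (f : {mpoly K[m * m]}) :
    {mpoly K[m * m]} :=
  let gP := map_mx (@mpolyC (m * m) K) g in
  mxsubst f (gP^T *m coord_mx m *m gP).

Definition O_invariant m (f : {mpoly K[m * m]}) : Prop :=
  forall g : 'M[K]_m, orthogonal_mx g -> conj_act g f = f.

Definition embed_mx (T : nmodType) n (x : 'M[T]_n) : 'M[T]_n.+1 :=
  castmx (addn1 n, addn1 n) (block_mx x 0 0 (0 : 'M[T]_1)).

Definition restr n (f : {mpoly K[n.+1 * n.+1]}) : {mpoly K[n * n]} :=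
  mxsubst f (embed_mx (coord_mx n)).

Lemma mxsubst_eval m k (f : {mpoly K[m * m]}) (A : 'M[{mpoly K[k]}]_m)
    (v : 'I_k -> K) :
  (mxsubst f A).@[v] = mxeval f (map_mx (meval v) A).
Proof.
rewrite /mxsubst comp_mpoly_meval /mxeval; apply: meval_eq => l.
by rewrite tnth_mktuple -map_mxvec mxE.
Qed.

Lemma coord_mx_eval m (x : 'M[K]_m) :
  map_mx (meval (fun k => mxvec x 0 k)) (coord_mx m) = x.
Proof. by apply/matrixP=> i j; rewrite !mxE mevalXU mxvecE. Qed.

Lemma map_embed_mx (T U : nmodType) (h : {additive T -> U}) n (x : 'M[T]_n) :
  map_mx h (embed_mx x) = embed_mx (map_mx h x).
Proof. by rewrite /embed_mx map_castmx map_block_mx !raddf0. Qed.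

Lemma conj_actE m (g : 'M[K]_m) (f : {mpoly K[m * m]}) (x : 'M[K]_m) :
  mxeval (conj_act g f) x = mxeval f (g^T *m x *m g).
Proof.
rewrite {1}/mxeval mxsubst_eval !map_mxM coord_mx_eval -map_trmx.
suff -> : map_mx (meval (fun k => mxvec x 0 k)) (map_mx (@mpolyC _ K) g) = g.
  by [].
by apply/matrixP=> i j; rewrite !mxE mevalC.
Qed.

Lemma restrE n (f : {mpoly K[n.+1 * n.+1]}) (x : 'M[K]_n) :
  mxeval (restr f) x = mxeval f (embed_mx x).
Proof.
by rewrite {1}/mxeval mxsubst_eval map_embed_mx coord_mx_eval.
Qed.

Lemma mxsubst_homog m k d (f : {mpoly K[m * m]}) (A : 'M[{mpoly K[k]}]_m) :
  f \is d.-homog -> (forall i j, A i j \is 1.-homog) ->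
  mxsubst f A \is d.-homog.
Proof.
move=> fd Ad; rewrite /mxsubst comp_mpolyE big_seq rpred_sum // => a am.
apply: rpredZ; rewrite -(dhomog_mf fd am) /= mdegE.
have H (l : 'I_(m * m)) :
    tnth [tuple mxvec A 0 l | l < m * m] l ^+ a l \is (a l).-homog.
  rewrite tnth_mktuple -[in X in X.-homog](mul1n (a l)).
  apply: dhomogMn; case/mxvec_indexP: l => i j; rewrite mxvecE; exact: Ad.
elim: (index_enum _) => [|l s IH]; rewrite ?big_nil ?dhomog1 // !big_cons.
exact: dhomogM.
Qed.

Lemma coord_mx_homog m i j : coord_mx m i j \is 1.-homog.
Proof. by rewrite mxE dhomogX /= mdeg1. Qed.

Lemma conj_act_homog m d (g : 'M[K]_m) (f : {mpoly K[m * m]}) :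
  f \is d.-homog -> conj_act g f \is d.-homog.
Proof.
move=> fd; apply: mxsubst_homog => // i j; rewrite mxE rpred_sum // => l _.
rewrite !mxE mulrC mul_mpolyC rpredZ // rpred_sum // => l' _.
by rewrite !mxE mul_mpolyC rpredZ // dhomogX /= mdeg1.
Qed.

Lemma restr_homog n d (f : {mpoly K[n.+1 * n.+1]}) :
  f \is d.-homog -> restr f \is d.-homog.
Proof.
move=> fd; apply: mxsubst_homog => // i j; rewrite castmxE /=.
set i' := cast_ord _ i; set j' := cast_ord _ j.
rewrite -(splitK i') -(splitK j'); case: (split i') => a; case: (split j') => b;
  rewrite /= ?block_mxEul ?block_mxEur ?block_mxEdl ?block_mxEdr.
- exact: coord_mx_homog.
- by rewrite mxE rpred0.
- by rewrite mxE rpred0.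
- by rewrite mxE rpred0.
Qed.

Lemma mxsubst_comp m k (f : {mpoly K[m * m]}) p
    (A : 'M[{mpoly K[p * p]}]_m) (B : 'M[{mpoly K[k]}]_p) :
  mxsubst (mxsubst f A) B = mxsubst f (map_mx (fun q => mxsubst q B) A).
Proof.
rewrite /mxsubst (comp_mpolyE f) raddf_sum (comp_mpolyE f); apply: eq_bigr => a _.
rewrite /= comp_mpolyZ rmorph_prod; congr (_ *: _).
apply: eq_bigr => l _; rewrite rmorphXn !tnth_mktuple /=.
by case/mxvec_indexP: l => i j; rewrite !mxvecE mxE.
Qed.

Lemma restr_invariant n (f : {mpoly K[n.+1 * n.+1]}) :
  O_invariant f -> O_invariant (restr f).
Proof.
move=> finv g og.
pose g1 : 'M[K]_n.+1 :=
  castmx (addn1 n, addn1 n) (block_mx g 0 0 (1%:M : 'M_1)).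
have castM (S : pzRingType) (A B : 'M[S]_(n + 1)) :
    castmx (addn1 n, addn1 n) A *m castmx (addn1 n, addn1 n) B
    = castmx (addn1 n, addn1 n) (A *m B).
  by move: (addn1 n) A B; case: _ / => A B; rewrite !castmx_id.
have cast1 : castmx (addn1 n, addn1 n) (1%:M : 'M[K]_(n + 1)) = 1%:M.
  by case: _ / (addn1 n); rewrite castmx_id.
have og1 : orthogonal_mx g1.
  rewrite /orthogonal_mx /g1 trmx_cast /= tr_block_mx castM mulmx_block.
  rewrite !trmx0 !trmx1 !mulmx0 !mul0mx !addr0 !add0r mulmx1 og.
  by rewrite -scalar_mx_block cast1.
rewrite -[in RHS](finv _ og1) /conj_act /restr !mxsubst_comp; congr mxsubst.
set s1 := fun q => mxsubst q _; set s2 := fun q => mxsubst q _.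
have sX p (B : 'M[{mpoly K[n * n]}]_p) :
    map_mx (fun q => mxsubst q B) (coord_mx p) = B.
  apply/matrixP => i j; rewrite !mxE /mxsubst comp_mpolyXU -tnth_nth.
  by rewrite tnth_mktuple mxvecE.
have sC p (B : 'M[{mpoly K[n * n]}]_p) q (h : 'M[K]_q) :
    map_mx (fun q => mxsubst q B) (map_mx (@mpolyC _ K) h)
    = map_mx (@mpolyC _ K) h.
  by apply/matrixP => i j; rewrite !mxE /mxsubst comp_mpolyC.
have sM p (B : 'M[{mpoly K[n * n]}]_p) q (A1 A2 : 'M_q) :
    map_mx (fun q => mxsubst q B) (A1 *m A2)
    = map_mx (fun q => mxsubst q B) A1 *m map_mx (fun q => mxsubst q B) A2.
  exact: (map_mxM (comp_mpoly [tuple mxvec B 0 l | l < p * p])).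
have sE p (B : 'M[{mpoly K[n * n]}]_p) (A : 'M_n) :
    map_mx (fun q => mxsubst q B) (embed_mx A)
    = embed_mx (map_mx (fun q => mxsubst q B) A).
  exact: (map_embed_mx (comp_mpoly [tuple mxvec B 0 l | l < p * p])).
rewrite /s1 /s2 sE sX !sM sX -map_trmx !sC map_trmx.
have -> : map_mx (@mpolyC (n * n) K) g1 =
    castmx (addn1 n, addn1 n)
      (block_mx (map_mx (@mpolyC (n * n) K) g) 0 0 (1%:M : 'M_1)).
  by rewrite map_castmx map_block_mx !raddf0 map_mx1.
rewrite /embed_mx trmx_cast /= tr_block_mx !castM !mulmx_block.
by rewrite !trmx0 !mulmx0 !mul0mx !addr0 ?mul0mx ?addr0 map_trmx.
Qed.

End PolynomialFunctions.

(* Main.v *)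
(* Put m = n + 1 and let f be an O_m-invariant of degree m vanishing on M_n.
   Diagonal sign matrices force every index to occur an even number of times in
   each monomial of f, and vanishing on M_n forces it to occur; as a monomial has
   2m index slots, every index occurs exactly twice, so f(d x d) = det(d)^2 f(x)
   for diagonal d. Orthogonal and diagonal matrices generate all matrices, whence
   f(g^T x g) = det(g)^2 f(x) for every g.

   Such a semi-invariant is affine in each diagonal entry of x, with slope the
   value of f after splitting off a 1 x 1 identity block. By induction on the size,
   if f vanishes on all the forms I_i (+) J_2 (+) ... (+) J_2 then f depends only
   on the skew part of x, which is congruent to a degenerate matrix or to
   J_2 (+) ... (+) J_2; hence f = 0. So f is determined by its values at these
   m./2 + 1 normal forms. Conversely det(s + c a), where s and a are the symmetric
   and skew parts of x, is a relation for every scalar c, with value c ^ 2j at the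
   normal form having j blocks J_2; letting c range over 0, ..., m./2 gives an
   invertible Vandermonde matrix. *)
Require Import Defs.
From HB Require Import structures.
From mathcomp Require Import all_boot all_order all_algebra perm.
From mathcomp Require Import complex reals.
From mathcomp Require Import mpoly.
From mathcomp Require Import zify ring.

Set Implicit Arguments.
Unset Strict Implicit.
Unset Printing Implicit Defensive.

Import Order.TTheory GRing.Theory Num.Theory.
Local Open Scope ring_scope.

(** * Polynomials are determined by their values *)

(** Uniqueness of base [B] digits keeps distinct monomials apart under the Kronecker
    substitution. *)
Lemma base_digits_inj (n B : nat) (a b : 'I_n -> nat) :
  (forall i, a i < B)%N -> (forall i, b i < B)%N ->
  (\sum_i a i * B ^ i = \sum_i b i * B ^ i)%N -> a =1 b.
Proof.
elim: n a b => [|n IH] a b aB bB; first by move=> _ [].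
have B0 : (0 < B)%N by apply: leq_ltn_trans (aB ord0).
rewrite !big_ord_recl /= !expn0 !muln1.
have shift (c : 'I_n.+1 -> nat) : (\sum_(i < n) c (lift ord0 i) * B ^ bump 0 i =
    (\sum_(i < n) c (lift ord0 i) * B ^ i) * B)%N.
  rewrite big_distrl; apply: eq_bigr => i _ /=.
  by rewrite /bump add1n expnS -mulnA [(B * _)%N]mulnC.
rewrite !shift => eq_ab.
have eq0 : a ord0 = b ord0.
  by move: (congr1 (modn^~ B) eq_ab); rewrite /= ![(_ + _ * B)%N]addnC !modnMDl !modn_small.
have /IH eqS : (\sum_(i < n) a (lift ord0 i) * B ^ i =
    \sum_(i < n) b (lift ord0 i) * B ^ i)%N.
  by move/eqP: eq_ab; rewrite eq0 eqn_add2l eqn_pmul2r // => /eqP.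
move=> i; case: (unliftP ord0 i) => [j ->|-> //]; exact: eqS.
Qed.

(* Kronecker substitution: [v i = t ^ (B ^ i)] with [B] exceeding every exponent. *)
Lemma mpoly_eval_eq0 (K : numFieldType) (n : nat) (f : {mpoly K[n]}) :
  (forall v : 'I_n -> K, f.@[v] = 0) -> f = 0.
Proof.
move=> f0; pose B := msize f.
pose kappa (a : 'X_{1..n}) := (\sum_i a i * B ^ i)%N.
pose P := \sum_(a <- msupp f) f@_a *: 'X^(kappa a) : {poly K}.
have P0 : P = 0.
  apply: (@roots_geq_poly_eq0 _ _ [seq i%:R : K | i <- iota 0 (size P)]).
  - apply/allP => _ /mapP[t _ ->]; rewrite /root -(f0 (fun i => t%:R ^+ (B ^ i))).
    rewrite mevalE horner_sum; apply/eqP; apply: eq_bigr => a _.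
    rewrite hornerZ hornerXn /kappa -prodrXr; congr (_ * _).
    by apply: eq_bigr => i _; rewrite -exprM mulnC.
  - by rewrite map_inj_uniq ?iota_uniq // => i j /eqP; rewrite eqr_nat => /eqP.
  - by rewrite size_map size_iota.
apply/mpolyP => a; rewrite mcoeff0; apply/eqP/negPn/negP; rewrite -mcoeff_msupp => fa.
(* Every exponent is at most the degree, which is less than [B = msize f]. *)
have digit b : b \in msupp f -> forall i, (b i < B)%N.
  move=> bf i; apply: leq_ltn_trans (msize_mdeg_lt bf).
  by rewrite mdegE (bigD1 i) //= leq_addr.
move: (congr1 (fun Q : {poly K} => Q`_(kappa a)) P0).
rewrite coef0 coef_sum (bigD1_seq a) //= coefZ coefXn eqxx mulr1 big1_seq.
  by rewrite addr0; apply/eqP; rewrite -mcoeff_msupp.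
move=> b /andP[ba bf]; rewrite coefZ coefXn; case: eqP => [eq_k|]; last by rewrite mulr0.
case/eqP: ba; apply/mnmP; apply: (@base_digits_inj _ B) => //; exact: digit.
Qed.

Lemma mxeval_inj (K : numFieldType) m (f g : {mpoly K[m * m]}) :
  (forall x, mxeval f x = mxeval g x) -> f = g.
Proof.
move=> fg; apply/eqP; rewrite -subr_eq0; apply/eqP/mpoly_eval_eq0 => v.
have -> : (f - g).@[v] = mxeval (f - g) (vec_mx (\row_k v k)).
  by apply: meval_eq => k; rewrite vec_mxK mxE.
by rewrite /mxeval mevalB [_.@[_]]fg subrr.
Qed.

(** * Weights of monomials under diagonal congruence *)

Section TorusWeights.
Variables (K : numFieldType) (m : nat).
Implicit Types (f : {mpoly K[m * m]}) (x : 'M[K]_m) (d : 'rV[K]_m).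

(** The exponent of [d_i] in the factor by which the monomial scales under [x |-> d x d], for [d]
    diagonal; the variable [x_ii] counts twice. *)
Definition index_weight (a : 'X_{1..m * m}) (i : 'I_m) : nat :=
  (\sum_j a (mxvec_index i j) + \sum_j a (mxvec_index j i))%N.

(** Each variable [x_ij] is counted once through its row [i] and once through its column [j]. *)
Lemma sum_index_weight a : (\sum_i index_weight a i = (mdeg a).*2)%N.
Proof.
rewrite /index_weight big_split /= [X in (_ + X)%N]exchange_big /= addnn mdegE.
congr (_.*2); rewrite pair_bigA /=.
rewrite [RHS](reindex (uncurry (@mxvec_index m m))) /=; last exact: curry_mxvec_bij.
by apply: eq_bigr => -[i j].
Qed.

(** The polynomial [f(d x d)], given by its coefficients so that identities between values turn into
    conditions on each weight. *)
Definition torus_act d f : {mpoly K[m * m]} :=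
  \sum_(a <- msupp f) (f@_a * \prod_i d 0 i ^+ index_weight a i) *: 'X_[a].

Lemma torus_act_coef d f a :
  (torus_act d f)@_a = f@_a * \prod_i d 0 i ^+ index_weight a i.
Proof.
rewrite /torus_act raddf_sum /=; case: (boolP (a \in msupp f)) => fa.
  rewrite (bigD1_seq a) //= mcoeffZ mcoeffX eqxx mulr1 [X in _ + X]big1 ?addr0 // => b ba.
  by rewrite mcoeffZ mcoeffX (negPf ba) mulr0.
rewrite (memN_msupp_eq0 fa) mul0r big1_seq // => b /andP[_ fb].
rewrite mcoeffZ mcoeffX; case: eqP fb fa => [-> ->//|]; by rewrite mulr0.
Qed.

Lemma torus_actE d f x :
  mxeval (torus_act d f) x = mxeval f ((diag_mx d)^T *m x *m diag_mx d).
Proof.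
rewrite /mxeval /torus_act raddf_sum /= mevalE; apply: eq_bigr => a _.
rewrite mevalZ mevalX -mulrA; congr (_ * _).
rewrite /index_weight [X in X * _](eq_bigr _ (fun i _ => exprD _ _ _)) big_split /=.
rewrite [X in X * _ * _](eq_bigr _ (fun i _ => esym (prodrXr _ _ _ _))).
rewrite [X in _ * X * _](eq_bigr _ (fun i _ => esym (prodrXr _ _ _ _))).
rewrite [X in _ * X * _]exchange_big /= !pair_bigA -big_split /=.
rewrite [X in _ * X](reindex (uncurry (@mxvec_index m m))) /=; last exact: curry_mxvec_bij.
rewrite [RHS](reindex (uncurry (@mxvec_index m m))) /=; last exact: curry_mxvec_bij.
rewrite -big_split /=; apply: eq_bigr => -[i j] _ /=.
by rewrite !mxvecE tr_diag_mx mul_mx_diag mul_diag_mx !mxE !exprMn mulrAC.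
Qed.

Lemma torus_act_evalP d f g :
  (forall x, mxeval f ((diag_mx d)^T *m x *m diag_mx d) = mxeval g x) ->
  torus_act d f = g.
Proof. by move=> fg; apply: mxeval_inj => x; rewrite torus_actE fg. Qed.

(* Invariance under diag(1,..,-1,..,1) makes every weight even, vanishing on
   matrices with a zero row and column makes it positive, and the weights of a
   monomial of degree [m] sum to [2m]: hence all of them equal 2. *)
Lemma torus_semi_invariant f d x :
  f \is m.-homog -> O_invariant f ->
  (forall i y, row i y = 0 -> col i y = 0 -> mxeval f y = 0) ->
  mxeval f ((diag_mx d)^T *m x *m diag_mx d) = (\det (diag_mx d)) ^+ 2 * mxeval f x.
Proof.
move=> f_homog f_inv f_van.
have weight a : a \in msupp f -> forall i, index_weight a i = 2%N.
  move=> fa.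
  have fa0 : f@_a != 0 by rewrite -mcoeff_msupp.
  have w_gt0 i : (0 < index_weight a i)%N.
    pose d0 : 'rV[K]_m := \row_j (j != i)%:R.
    have d0f : torus_act d0 f = 0.
      apply: torus_act_evalP => y; rewrite [RHS]meval0; apply: (f_van i).
        rewrite tr_diag_mx mul_mx_diag mul_diag_mx; apply/rowP => j.
        by rewrite !mxE eqxx !mul0r.
      rewrite tr_diag_mx mul_mx_diag mul_diag_mx; apply/colP => j.
      by rewrite !mxE eqxx mulr0.
    (* Were the weight of [i] zero, [d0] would fix the monomial, as [0 ^ 0 = 1], and its coefficient
       would survive in the zero polynomial. *)
    rewrite lt0n; apply/negP => /eqP w0; case/eqP: fa0.
    move: (congr1 (mcoeff a) d0f); rewrite torus_act_coef mcoeff0 big1 ?mulr1 // => j _.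
    by rewrite mxE; case: (eqVneq j i) => [->|_]; rewrite ?w0 ?expr0 ?expr1n.
  have w_even i : ~~ odd (index_weight a i).
    pose d1 : 'rV[K]_m := \row_j (-1) ^+ (j == i).
    have d1f : torus_act d1 f = f.
      apply: torus_act_evalP => y; rewrite -conj_actE f_inv //.
      rewrite /orthogonal_mx tr_diag_mx mulmx_diag; apply/matrixP => p q.
      by rewrite !mxE -expr2 -exprM mulnC exprM sqrrN !expr1n.
    apply/negP => w_odd; case/negP: fa0.
    move: (congr1 (mcoeff a) d1f); rewrite torus_act_coef (bigD1 i) //= big1 => [|j ji].
      rewrite mxE eqxx expr1 -signr_odd w_odd expr1 mulr1 mulrN1 => /eqP.
      by rewrite eq_sym -addr_eq0 -mulr2n mulrn_eq0.
    by rewrite mxE (negPf ji) expr1n.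
  have w_ge2 i : (2 <= index_weight a i)%N.
    by move: (w_gt0 i) (w_even i); case: (index_weight a i) => [|[|]].
  have : (\sum_i (index_weight a i - 2) = 0)%N.
    rewrite sumnB // sum_index_weight sum_nat_const card_ord.
    by rewrite (dhomog_mf f_homog fa) muln2 subnn.
  move/eqP; rewrite sum_nat_eq0 => /forallP w2 i.
  by apply/eqP; rewrite eqn_leq w_ge2 -subn_eq0 andbT; apply: w2.
rewrite -torus_actE /mxeval mulrC [in RHS]mevalE mulr_suml.
rewrite /torus_act raddf_sum /=; apply: eq_big_seq => a fa.
rewrite mevalZ mevalX det_diag -prodrXl mulrAC; congr (_ * _ * _).
by apply: eq_bigr => i _; rewrite weight.
Qed.

End TorusWeights.

(** * Generators of the monoid of square matrices *)

(** Gaussian elimination, by induction on the size: transpositions bring a nonzero entry to the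
    corner, transvections clear its row and column, and the remaining block is handled by
    induction. *)
Lemma matrix_generation (K : fieldType) (n : nat) (G : 'M[K]_n -> Prop) :
  (forall A B, G A -> G B -> G (A *m B)) ->
  (forall d, G (diag_mx d)) -> (forall i j, G (tperm_mx i j)) ->
  (forall i j t, i != j -> G (1%:M + t *: delta_mx i j)) ->
  forall A, G A.
Proof.
elim: n G => [|n IH] G GM Gd Gp Gt A.
  by rewrite [A]thinmx0 -[0](_ : diag_mx 0 = _) // [LHS]thinmx0.
(* The closure hypotheses are restated at size [1 + n], so that block lemmas apply. *)
have {}GM (B C : 'M_(1 + n)) : G B -> G C -> G (B *m C) := GM B C.
have {}Gt (i j : 'I_(1 + n)) t : i != j -> G (1%:M + t *: delta_mx i j) := Gt i j t.
have {}Gd (d : 'rV_(1 + n)) : G (diag_mx d) := Gd d.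
have G1dr (C : 'M_n) : G (block_mx (1%:M : 'M_1) 0 0 C).
  pose G' (B : 'M_n) := G (block_mx (1%:M : 'M_1) 0 0 B); rewrite -/(G' C).
  apply: IH C => [B C|d|i j|i j t ij]; rewrite /G'.
  - move=> GB GC; have := GM _ _ GB GC.
    by rewrite mulmx_block !mulmx0 !mul0mx !addr0 !add0r mulmx1.
  - by rewrite -diag_const_mx -diag_mx_row; apply: Gd.
  - suff -> : block_mx (1%:M : 'M_1) 0 0 (tperm_mx i j) =
        tperm_mx (lift ord0 i) (lift ord0 j) :> 'M[K]_(1 + n) by apply: Gp.
    rewrite -[LHS]/(lift0_mx _) lift0_mx_perm; congr perm_mx; apply/permP => k.
    case: (unliftP 0 k) => [k'|] ->; first by rewrite lift0_perm_lift inj_tperm //; apply: lift_inj.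
    by rewrite lift0_perm0 tpermD // eq_sym neq_lift.
  - suff -> : block_mx (1%:M : 'M_1) 0 0 (1%:M + t *: delta_mx i j) =
        1%:M + t *: delta_mx (rshift 1 i) (rshift 1 j) :> 'M[K]_(1 + n).
      by apply: Gt; rewrite eq_rshift.
    rewrite delta_mx_dshift delta_mx_rshift -(row_mx0 K 1 1 n) -/(block_mx _ _ _ _).
    by rewrite scalar_mx_block scale_block_mx add_block_mx !scaler0 !addr0.
have Gur (r : 'rV_n) : G (block_mx (1%:M : 'M_1) r 0 1%:M).
  rewrite [r]row_sum_delta; elim/big_rec: _ => [|i s _ Gs].
    by rewrite -scalar_mx_block -diag_const_mx.
  have : G (1%:M + r 0 i *: delta_mx (lshift n (0 : 'I_1)) (rshift 1 i)).
    by apply: Gt; rewrite eq_lrshift.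
  move/GM/(_ Gs); congr G.
  rewrite delta_mx_ushift delta_mx_rshift -(row_mx0 K n 1 n) -/(block_mx _ _ _ _).
  rewrite scalar_mx_block scale_block_mx add_block_mx mulmx_block.
  by rewrite !scaler0 !addr0 !add0r !mulmx0 !mul0mx !mul1mx !mulmx1 !addr0 add0r addrC.
have Gdl (c : 'cV_n) : G (block_mx (1%:M : 'M_1) 0 c 1%:M).
  rewrite -[c]trmxK [c^T]row_sum_delta; elim/big_rec: _ => [|i s _ Gs].
    by rewrite trmx0 -scalar_mx_block -diag_const_mx.
  have : G (1%:M + c^T 0 i *: delta_mx (rshift 1 i) (lshift n (0 : 'I_1))).
    by apply: Gt; rewrite eq_rlshift.
  move/GM/(_ Gs); congr G.
  rewrite delta_mx_dshift delta_mx_lshift -(row_mx0 K 1 1 n) -/(block_mx _ _ _ _).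
  rewrite scalar_mx_block scale_block_mx add_block_mx mulmx_block linearD linearZ /= trmx_delta.
  by rewrite !scaler0 !addr0 !add0r !mulmx0 !mul0mx !mul1mx !mulmx1 !addr0 add0r.
have Gpivot (B : 'M_(1 + n)) : B 0 0 != 0 -> G B.
  move=> p0; set p := B 0 0 in p0.
  (* Block LDU factorization around the pivot [p]; the last diagonal block is the Schur
     complement. *)
  suff -> : B = block_mx 1%:M 0 (p^-1 *: dlsubmx B) 1%:M *m
      (diag_mx (row_mx (const_mx p) (const_mx 1)) *m
       block_mx 1%:M 0 0 (drsubmx B - p^-1 *: (dlsubmx B *m ursubmx B))) *m
      block_mx 1%:M (p^-1 *: ursubmx B) 0 1%:M.
    by apply: (GM) (Gur _); apply: (GM) (Gdl _) _; apply: (GM).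
  have ulB : ulsubmx B = p%:M.
    by apply/matrixP => i j; rewrite !ord1 !mxE mulr1n; congr (B _ _); apply: val_inj.
  rewrite diag_mx_row !diag_const_mx !mulmx_block !mulmx0 !mul0mx !mulmx1 !mul1mx.
  rewrite !addr0 !add0r mul_scalar_mx scalerA divff // scale1r mul_mx_scalar scalerA divff //.
  by rewrite scale1r -scalemxAr mulmx0 add0r addrC subrK -ulB submxK.
case: (eqVneq A 0) => [->|/matrix0Pn[i [j Aij]]].
  by rewrite -[0](_ : diag_mx 0 = _) // linear0.
have -> : A = tperm_mx 0 i *m (tperm_mx 0 i *m A *m tperm_mx j 0) *m tperm_mx j 0.
  rewrite !mulmxA -mulmxA -[X in _ *m _ *m A *m X]perm_mxM -perm_mxM !tperm2 !perm_mx1.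
  by rewrite mul1mx mulmx1.
apply: (GM) (Gp _ _); apply: (GM) (Gp _ _) _; apply: Gpivot.
by rewrite -xrowE -xcolE !mxE tpermR tpermL.
Qed.

Section OrthogonalDiagonalGeneration.
Variables (K : numFieldType) (n : nat) (G : 'M[K]_n -> Prop).
Hypothesis G_mul : forall A B, G A -> G B -> G (A *m B).
Hypothesis G_diag : forall d, G (diag_mx d).
Hypothesis G_orth : forall g, orthogonal_mx g -> G g.

Let mx2 (p q r s : K) : 'M_(1 + 1) := block_mx p%:M q%:M r%:M s%:M.

Let mx2M p q r s p' q' r' s' : mx2 p q r s *m mx2 p' q' r' s' =
  mx2 (p * p' + q * r') (p * q' + q * s') (r * p' + s * r') (r * q' + s * s').
Proof. by rewrite mulmx_block -!scalar_mxM -!raddfD. Qed.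

Let mx2_1 : mx2 1 0 0 1 = 1%:M.
Proof. by rewrite /mx2 (scalar_mx_block 1 1) !raddf0. Qed.

(* A transvection is [R D R'] with [D] diagonal and [R], [R'] rotations: for
   [D = diag(4/3, 3/4)] the rotations come from the (3, 4, 5) triangle and the
   off-diagonal entry is [4/3 - 3/4 = 7/12], which diagonal matrices rescale. *)
Lemma transvection_generation (i j : 'I_n) (t : K) :
  i != j -> G (1%:M + t *: delta_mx i j).
Proof.
move=> ij.
pose P : 'M[K]_(n, 1 + 1) := row_mx (delta_mx i 0) (delta_mx j 0).
have PP : P^T *m P = 1%:M.
  rewrite /P tr_row_mx !trmx_delta mul_col_row !mul_delta_mx !mul_delta_mx_cond.
  rewrite (negPf ij) eq_sym (negPf ij) !mulr0n scalar_mx_block.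
  by congr block_mx; apply/matrixP => a b; rewrite !mxE !ord1.
pose emb h := 1%:M + P *m (h - 1%:M) *m P^T.
have embM h h' : emb h *m emb h' = emb (h *m h').
  have -> : emb (h *m h') = 1%:M + P *m ((h - 1%:M) + (h' - 1%:M) +
      (h - 1%:M) *m (h' - 1%:M)) *m P^T.
    rewrite /emb; congr (_ + _ *m _ *m _).
    rewrite mulmxBr mulmx1 mulmxBl mul1mx.
    by rewrite [RHS]addrC addrA subrK addrA subrK.
  rewrite /emb; move: (h - _) (h' - _) => a b.
  rewrite mulmxDl mul1mx mulmxDr mulmx1 mulmxDr mulmxDl mulmxDr mulmxDl.
  have -> : P *m a *m P^T *m (P *m b *m P^T) = P *m (a *m b) *m P^T.
    by rewrite !mulmxA -(mulmxA _ P^T P) PP mulmx1.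
  by rewrite -!addrA; congr (_ + _); rewrite addrCA.
have emb_orth h : h^T *m h = 1%:M -> G (emb h).
  move=> hh; apply: G_orth; rewrite /orthogonal_mx.
  have -> : (emb h)^T = emb h^T.
    by rewrite /emb linearD /= !trmx_mul trmxK linearB /= !trmx1 mulmxA.
  by rewrite embM hh /emb subrr mulmx0 mul0mx addr0.
have embE p q r s : emb (mx2 p q r s) = 1%:M + ((p - 1) *: delta_mx i i + r *: delta_mx j i
    + (q *: delta_mx i j + (s - 1) *: delta_mx j j)).
  rewrite /emb -mx2_1 /mx2 opp_block_mx add_block_mx -!raddfB /= !subr0 /P tr_row_mx.
  rewrite mul_row_block mul_row_col !trmx_delta !mul_mx_scalar !mulmxDl.
  by rewrite -!scalemxAl !mul_delta_mx.
have emb_diag p s : G (emb (mx2 p 0 0 s)).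
  rewrite embE !scale0r addr0 add0r.
  suff -> : 1%:M + ((p - 1) *: delta_mx i i + (s - 1) *: delta_mx j j) =
    diag_mx (\row_k (1 + (p - 1) * (k == i)%:R + (s - 1) * (k == j)%:R)) by apply: G_diag.
  apply/matrixP => k l; rewrite !mxE; case: (eqVneq k l) => [->|kl].
    by rewrite !andbb !mulr1n addrA.
  rewrite !mulr0n add0r; have neq (a : 'I_n) : (k == a) && (l == a) = false.
    by apply: contraNF kl => /andP[/eqP -> /eqP ->].
  by rewrite !neq !mulr0 addr0.
have emb_mx2 p q r s p' q' r' s' : G (emb (mx2 p q r s)) -> G (emb (mx2 p' q' r' s')) ->
    G (emb (mx2 (p * p' + q * r') (p * q' + q * s') (r * p' + s * r') (r * q' + s * s'))).
  by move=> g g'; rewrite -mx2M -embM; apply: G_mul.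
have emb_rot c s : c ^+ 2 + s ^+ 2 = 1 -> G (emb (mx2 c s (- s) c)).
  move=> cs; apply: emb_orth; rewrite tr_block_mx !tr_scalar_mx -/(mx2 _ _ _ _) -mx2_1 mx2M.
  by congr mx2; rewrite -?cs; ring.
have emb_eq p q r s p' q' r' s' : p = p' -> q = q' -> r = r' -> s = s' ->
    G (emb (mx2 p q r s)) -> G (emb (mx2 p' q' r' s')) by move=> -> -> -> ->.
have base : G (emb (mx2 1 (7 / 12) 0 1)).
  have /emb_rot rot1 : (4 / 5) ^+ 2 + (- (3 / 5)) ^+ 2 = 1 :> K by field.
  have /emb_rot rot2 : (3 / 5) ^+ 2 + (4 / 5) ^+ 2 = 1 :> K by field.
  by apply: emb_eq (emb_mx2 _ _ _ _ _ _ _ _ (emb_mx2 _ _ _ _ _ _ _ _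
    rot1 (emb_diag (4 / 3) (3 / 4))) rot2); field.
(* The case [t = 0] is separate because the rescaling below conjugates by [diag(12 t / 7, 1)], which
   must be invertible. *)
case: (eqVneq t 0) => [->|t0].
  by rewrite scale0r addr0 -diag_const_mx.
suff -> : 1%:M + t *: delta_mx i j = emb (mx2 1 t 0 1).
  by apply: emb_eq (emb_mx2 _ _ _ _ _ _ _ _ (emb_mx2 _ _ _ _ _ _ _ _
    (emb_diag (12 / 7 * t) 1) base) (emb_diag (12 / 7 * t)^-1 1)); field.
by rewrite embE subrr !scale0r !add0r addr0.
Qed.

Lemma orthogonal_diagonal_generation (A : 'M[K]_n) : G A.
Proof.
apply: matrix_generation A => // [i j|i j t]; last exact: transvection_generation.
apply: G_orth; rewrite /orthogonal_mx tr_tperm_mx -perm_mxM.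
by rewrite tperm2 perm_mx1.
Qed.
End OrthogonalDiagonalGeneration.

(** * Semi-invariant functions of a bilinear form *)

Section SemiInvariant.
Variable K : numFieldType.

Definition semi_invariant k (phi : 'M[K]_k -> K) :=
  forall g x, phi (g^T *m x *m g) = (\det g) ^+ 2 * phi x.

(** A weak form of polynomiality that passes directly to block restrictions. The outer variable of
    [P] stands for [s], the variable of its coefficients for [t]. *)
Definition plane_polynomial k (phi : 'M[K]_k -> K) := forall x y z,
  exists P : {poly {poly K}}, forall s t, phi (x + s *: y + t *: z) = P.[s%:P].[t].

(** Allows a matrix to be replaced by a congruent one when proving vanishing. *)
Lemma semi_invariant_eq0 k (phi : 'M[K]_k -> K) g x : semi_invariant phi ->
  g \in unitmx -> phi (g^T *m x *m g) = 0 -> phi x = 0.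
Proof.
rewrite unitmxE unitfE => phiS gU /eqP.
by rewrite phiS mulf_eq0 expf_eq0 (negPf gU) => /eqP.
Qed.

(** Take [g = 0]: in positive size its determinant is zero. *)
Lemma semi_invariant0 k (phi : 'M[K]_k.+1 -> K) : semi_invariant phi -> phi 0 = 0.
Proof.
move=> phiS; have := phiS 0 0.
by rewrite mulmx0 det0 expr0n mul0r.
Qed.

Lemma semi_invariant_block l k (phi : 'M[K]_(l + k) -> K) (B : 'M_l) :
  semi_invariant phi -> semi_invariant (fun y => phi (block_mx B 0 0 y)).
Proof.
move=> phiS g x; have := phiS (block_mx 1%:M 0 0 g) (block_mx B 0 0 x).
rewrite tr_block_mx !mulmx_block !trmx0 trmx1 det_lblock det1 mul1r.
by rewrite !mulmx0 !mul0mx !addr0 !add0r mulmx1 mul1mx !mul0mx.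
Qed.

Lemma plane_polynomial_block l k (phi : 'M[K]_(l + k) -> K) (B : 'M_l) :
  plane_polynomial phi -> plane_polynomial (fun y => phi (block_mx B 0 0 y)).
Proof.
move=> phiP x y z.
have [P PE] := phiP (block_mx B 0 0 x) (block_mx 0 0 0 y) (block_mx 0 0 0 z).
by exists P => s t; rewrite -PE !scale_block_mx !add_block_mx !scaler0 !addr0.
Qed.

Lemma poly_eval_eq0 (p : {poly K}) : (forall t, t != 0 -> p.[t] = 0) -> p = 0.
Proof.
move=> p0; apply: (@roots_geq_poly_eq0 _ _ [seq i.+1%:R : K | i <- iota 0 (size p)]).
- by apply/allP => _ /mapP[t _ ->]; rewrite /root p0 ?pnatr_eq0.
- by rewrite map_inj_uniq ?iota_uniq // => i j /eqP; rewrite eqr_nat => /eqP[].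
- by rewrite size_map size_iota.
Qed.

(* Rescaling the first basis vector by [d] multiplies [phi] by [d ^ 2], so [phi]
   has weight 2 in the index 0, while the entry (0, 0) itself has weight 2. *)
Lemma semi_invariant_affine k (phi : 'M[K]_(1 + k) -> K) (x : 'M_(1 + k)) t :
  semi_invariant phi -> plane_polynomial phi ->
  phi (x + t *: block_mx (1%:M : 'M_1) 0 0 0) =
  phi x + t * phi (block_mx (1%:M : 'M_1) 0 0 (drsubmx x)).
Proof.
move=> phiS phiP.
pose y := drsubmx x; pose b := ursubmx x; pose c := dlsubmx x.
(* [P(s, d)] is the value of [phi] when the corner is [s] and the rest of the first row and column
   is scaled by [d]. *)
have [P PE] := phiP (block_mx 0 0 0 y) (block_mx (1%:M : 'M_1) 0 0 0) (block_mx 0 b c 0).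
have phiE s d : phi (block_mx s%:M (d *: b) (d *: c) y) = P.[s%:P].[d].
  rewrite -PE !scale_block_mx !add_block_mx !scaler0 !addr0 !add0r.
  by rewrite scale_scalar_mx mulr1.
have scale s d : P.[(s * d ^+ 2)%:P].[d] = d ^+ 2 * P.[s%:P].[1].
  rewrite -!phiE; have := phiS (block_mx d%:M 0 0 1%:M) (block_mx s%:M b c y).
  rewrite tr_block_mx !mulmx_block det_lblock det1 det_scalar1 mulr1 !scale1r => <-.
  rewrite !trmx0 trmx1 tr_scalar_mx !mulmx0 !mul0mx !addr0 !add0r !mulmx1 !mul1mx.
  by rewrite -!scalar_mxM !mul_scalar_mx !mul_mx_scalar expr2 mulrA [d * s]mulrC.
pose u := P`_0`_2; pose v := P`_1`_0.
(* Compare coefficients of [d ^ 2] in [P(s d ^ 2, d) = d ^ 2 P(s, 1)]: only the terms of degree 0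
   and 1 in [s] contribute. *)
have affine s : P.[s%:P].[1] = u + s * v.
  have Ps : P.[s *: 'X^2] = P.[s%:P].[1] *: 'X^2.
    apply/eqP; rewrite -subr_eq0; apply/eqP/poly_eval_eq0 => d _.
    rewrite hornerD hornerN hornerZ hornerXn mulrC -scale; apply/eqP; rewrite subr_eq0; apply/eqP.
    rewrite !(horner_coef P) !horner_sum; apply: eq_bigr => i _.
    by rewrite !hornerM !horner_exp hornerZ hornerXn hornerC.
  have := congr1 (fun p : {poly K} => p`_2) Ps.
  rewrite coefZ coefXn eqxx mulr1 => <-.
  rewrite (@horner_coef_wide _ (size P).+2) ?leqW // coef_sum.
  rewrite !big_ord_recl big1 /= => [|i _]; last first.
    by rewrite exprZn -exprM -scalerAr coefZ coefMXn ifT ?mulr0 // /bump; lia.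
  by rewrite expr0 mulr1 expr1 -scalerAr coefZ coefMXn /= addr0.
(* Scaling with [s = d ^ -2] gives [P(1, d) = u d ^ 2 + v] for nonzero [d], hence identically; then
   set [d = 0]. *)
have P0 : P.[1%:P].[0] = v.
  have -> : P.[1%:P] = u *: 'X^2 + v%:P.
    apply/eqP; rewrite -subr_eq0; apply/eqP/poly_eval_eq0 => d d0.
    have := scale (d ^- 2) d; rewrite mulVf ?expf_neq0 // affine => Pd.
    rewrite hornerD hornerN Pd hornerD hornerZ hornerXn hornerC.
    by rewrite mulrDr mulrA divff ?expf_neq0 // mul1r mulrC subrr.
  by rewrite hornerD hornerZ hornerXn hornerC expr0n mulr0 add0r.
have xE : x = block_mx (x 0 0)%:M b c y.
  rewrite -[LHS]submxK; congr block_mx.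
  by apply/matrixP => i j; rewrite !ord1 !mxE mulr1n; congr (x _ _); apply: val_inj.
have -> : x + t *: block_mx (1%:M : 'M_1) 0 0 0 = block_mx (x 0 0 + t)%:M b c y.
  rewrite {1}xE scale_block_mx add_block_mx !scaler0 !addr0 scale_scalar_mx mulr1.
  by rewrite -raddfD.
rewrite [in phi x]xE -/y -[b]scale1r -[c]scale1r !phiE.
have := phiE 1 0; rewrite !scale0r => ->.
by rewrite P0 !affine; ring.
Qed.
End SemiInvariant.

(** * Normal forms under congruence *)

Section NormalForms.
Variable K : numFieldType.

(** The block [J_2], with rows [(0, 1)] and [(-1, 0)]. *)
Definition symplectic2 : 'M[K]_2 := \matrix_(p, q) ((p < q)%N%:R - (q < p)%N%:R).

Fixpoint symplectic_mx j : 'M[K]_j.*2 :=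
  if j is j'.+1 then block_mx symplectic2 0 0 (symplectic_mx j') : 'M_(2 + j'.*2) else 0.

(** The form [I_i (+) J_2 (+) ... (+) J_2] with [j] blocks [J_2]. Splitting blocks off at the front
    makes all sizes agree by conversion, without casts. *)
Fixpoint normal_mx i j : 'M[K]_(i + j.*2) :=
  if i is i'.+1 then block_mx (1%:M : 'M_1) 0 0 (normal_mx i' j) : 'M_(1 + (i' + j.*2))
  else symplectic_mx j.

Lemma symplectic2_sqr : symplectic2 *m symplectic2 = - 1%:M.
Proof.
apply/matrixP => p q; rewrite !mxE !big_ord_recl big_ord0 !mxE.
by case: p q => [[|[|p]] ?] [[|[|q]] ?] //=; rewrite ?mulr1n ?mulr0n; ring.
Qed.

(** Reduction of a skew form: a nonzero one splits off a block [J_2], and induction applies to the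
    complement; a zero form of positive size gives the value 0. *)
Lemma semi_invariant_skew k (phi : 'M[K]_k -> K) :
  semi_invariant phi ->
  (forall j (e : j.*2 = k), phi (castmx (e, e) (symplectic_mx j)) = 0) ->
  forall a : 'M_k, a^T = - a -> phi a = 0.
Proof.
have [N] := ubnP k; elim: N k phi => // N IH [|[|k]] phi kN phiS phi0 a aT.
- by rewrite -(phi0 0%N erefl) castmx_id; congr phi; apply/matrixP => -[].
- suff -> : a = 0 by exact: semi_invariant0.
  apply/matrixP => i j; rewrite !ord1 mxE; apply/eqP.
  by move/matrixP: aT => /(_ 0 0); rewrite !mxE => /eqP; rewrite -addr_eq0 -mulr2n mulrn_eq0.
have [->|/matrix0Pn[p [q apq]]] := eqVneq a 0; first exact: semi_invariant0.
have aE (b : 'M[K]_k.+2) : b^T = - b -> forall i j, b i j = - b j i.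
  by move=> bT i j; move/matrixP: bT => /(_ j i); rewrite !mxE.
have pq : p != q.
  apply: contraNneq apq => <-.
  by move: (aE a aT p p) => /eqP; rewrite -addr_eq0 -mulr2n mulrn_eq0.
(* A simultaneous permutation of rows and columns brings the nonzero entry to position [(0, 1)]. *)
have [s [s0 s1]] : exists s : {perm 'I_k.+2}, s 0 = p /\ s 1 = q.
  exists (tperm (1%R : 'I_k.+2) (tperm 0%R p q) * tperm 0%R p)%g; rewrite !permM; split.
    rewrite [tperm 1 _ 0]tpermD ?tpermL //.
    by rewrite -(inj_eq (@perm_inj _ (tperm 0 p))) tpermK tpermL eq_sym.
  by rewrite [tperm 1 _ 1]tpermL tpermK.
apply: (@semi_invariant_eq0 _ _ _ (perm_mx s)^T) => //.
  by rewrite tr_perm_mx unitmx_perm.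
rewrite trmxK tr_perm_mx -row_permE -col_permE.
set b : 'M_(2 + k) := col_perm s _.
have bT : b^T = - b by apply/matrixP => i j; rewrite !mxE aE // !mxE.
have b01 : b 0 1 = a p q by rewrite !mxE s0 s1.
move: b (a p q) apq bT b01 => {s s0 s1 p q pq a aT aE} b c c0 bT b01.
pose u := ulsubmx b; pose r := ursubmx b; pose w := - c^-1 *: symplectic2.
have uE : u = c *: symplectic2.
  have skew i j : b i j = - b j i by move/matrixP: bT => /(_ j i); rewrite !mxE.
  have diag0 i : b i i = 0.
    by move: (skew i i) => /eqP; rewrite -addr_eq0 -mulr2n mulrn_eq0 => /eqP.
  have ord2 (i : 'I_2) : i = 0 \/ i = 1.
    by case: i => [[|[|i]] // iP]; [left|right]; apply: val_inj.
  have l0 : lshift k (0 : 'I_2) = 0 by apply: val_inj.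
  have l1 : lshift k (1 : 'I_2) = 1 by apply: val_inj.
  apply/matrixP => i j; rewrite !mxE.
  case: (ord2 i) => ->; case: (ord2 j) => ->; rewrite ?l0 ?l1 ?diag0 ?[b 1 0]skew ?b01 /=;
    by rewrite ?mulr1n ?mulr0n; ring.
have wu : w *m u = 1%:M.
  by rewrite uE -scalemxAr -scalemxAl symplectic2_sqr scalerN scaleNr opprK scalerA divff ?scale1r.
have uw : u *m w = 1%:M by apply: mulmx1C.
have wT : w^T = - w.
  by rewrite linearZ /= -scalerN; congr (_ *: _); apply/matrixP => i j; rewrite !mxE opprB.
have dlE : dlsubmx b = - r^T.
  by rewrite -[b]trmxK -trmx_ursub bT; apply/matrixP => i j; rewrite !mxE.
(* The Schur complement of [u] in [b]: here [w] is the inverse of [u], and the lower left block is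
   [- r^T]. *)
pose d := drsubmx b + r^T *m w *m r.
apply: (@semi_invariant_eq0 _ _ _ (block_mx 1%:M (- (w *m r)) 0 1%:M)) => //.
  by rewrite unitmxE det_ublock !det1 mulr1 unitr1.
have -> : (block_mx 1%:M (- (w *m r)) 0 1%:M)^T *m b *m block_mx 1%:M (- (w *m r)) 0 1%:M =
    block_mx u 0 0 d.
  rewrite -[b in LHS]submxK tr_block_mx !mulmx_block dlE -/u -/r.
  rewrite trmx1 trmx0 !mul1mx !mul0mx !mulmx1 !mulmx0 !addr0.
  have -> : (- (w *m r))^T = r^T *m w by rewrite linearN /= trmx_mul wT mulmxN opprK.
  rewrite -[r^T *m w *m u]mulmxA wu mulmx1 !trmx1 !mul1mx subrr.
  rewrite mul0mx add0r mulmxN mulmxA uw mul1mx addNr.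
  by rewrite [_ + drsubmx b]addrC.
have psiS := @semi_invariant_block _ 2 k phi symplectic2 phiS.
suff : phi (block_mx symplectic2 0 0 d) = 0.
  (* Congruence by [diag(c, 1)] turns [J_2] into [c J_2 = u]. *)
  move=> phid; pose h : 'M[K]_2 := diag_mx (\row_i if i == 0 then c else 1).
  have -> : block_mx u 0 0 d = (block_mx h 0 0 1%:M)^T *m block_mx symplectic2 0 0 d *m
      block_mx h 0 0 1%:M.
    rewrite tr_block_mx !mulmx_block !trmx0 trmx1 !mulmx0 !mul0mx !addr0 !add0r mulmx1 mul1mx.
    suff -> : h^T *m symplectic2 *m h = u by rewrite mul0mx mulmx1.
    rewrite uE /h tr_diag_mx mul_mx_diag mul_diag_mx; apply/matrixP => i j; rewrite !mxE.
    by case: i j => [[|[|i]] // iP] [[|[|j]] // jP] /=; rewrite ?mulr1n ?mulr0n; ring.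
  by rewrite phiS phid mulr0.
apply: (IH k (fun y => phi (block_mx symplectic2 0 0 y))) => // [|j e|].
- by rewrite -ltnS ltnW.
- case: k / e phi phi0 {phiS psiS IH kN b bT b01 u r w uE wu uw wT dlE d} => phi phi0.
  by rewrite castmx_id; have := phi0 j.+1 erefl; rewrite castmx_id.
rewrite /d linearD /= opprD; congr (_ + _).
  by rewrite trmx_drsub bT; apply/matrixP => i j; rewrite !mxE.
by rewrite !trmx_mul trmxK wT mulNmx mulmxN mulmxA.
Qed.

(** A nonzero [v] is [c e_0 g] with [g] invertible, so [v^T v] is congruent to a multiple of the
    corner matrix unit. *)
Lemma semi_invariant_rank1 k (phi : 'M[K]_(1 + k) -> K) :
  semi_invariant phi ->
  (forall x t, phi (x + t *: block_mx (1%:M : 'M_1) 0 0 0) = phi x) ->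
  forall (v : 'rV_(1 + k)) x t, phi (x + t *: (v^T *m v)) = phi x.
Proof.
move=> phiS phi_inv v x t; have [->|v0] := eqVneq v 0.
  by rewrite mulmx0 scaler0 addr0.
pose g := row_ebase v; pose c := col_ebase v 0 0.
have gU : g \in unitmx by apply: row_ebase_unit.
have vE : v = c *: (row_mx 1%:M 0 *m g).
  rewrite -[LHS]mulmx_ebase rank_rV v0 pid_mx_row [col_ebase v]mx11_scalar -/c.
  by rewrite mul_scalar_mx scalemxAl.
have [x' xE] : exists x', x = g^T *m x' *m g.
  exists ((invmx g)^T *m x *m invmx g); rewrite !mulmxA -trmx_mul mulVmx // trmx1 mul1mx.
  by rewrite mulmxKV.
have vvE : v^T *m v = g^T *m (c ^+ 2 *: block_mx (1%:M : 'M_1) 0 0 0) *m g.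
  rewrite -scalemxAr -scalemxAl {1 2}vE; have -> (w : 'rV[K]_(1 + k)) :
      (c *: w)^T *m (c *: w) = c ^+ 2 *: (w^T *m w).
    by rewrite [(c *: w)^T]linearZ /= -scalemxAl -scalemxAr scalerA.
  rewrite trmx_mul tr_row_mx !mulmxA -[g^T *m _ *m row_mx _ _]mulmxA mul_col_row.
  by rewrite trmx1 trmx0 mulmx1 !mulmx0 mul0mx.
rewrite vvE [in RHS]xE [X in X + _]xE.
by rewrite scalemxAl scalemxAr scalerA -mulmxDl -mulmxDr !phiS phi_inv.
Qed.

Lemma semi_invariant_sym k (phi : 'M[K]_(1 + k) -> K) :
  semi_invariant phi ->
  (forall x t, phi (x + t *: block_mx (1%:M : 'M_1) 0 0 0) = phi x) ->
  forall x, phi x = phi (2^-1 *: (x - x^T)).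
Proof.
move=> phiS phi_inv x; have phi1 := semi_invariant_rank1 phiS phi_inv.
(* Polarization: [E_pq + E_qp] is the square of [e_p + e_q] minus the squares of [e_p] and [e_q]. *)
have phi2 p q y t : phi (y + t *: (delta_mx p q + delta_mx q p)) = phi y.
  pose e i : 'rV[K]_(1 + k) := delta_mx 0 i.
  have eE i j : (e i)^T *m e j = delta_mx i j by rewrite trmx_delta mul_delta_mx.
  rewrite -[RHS](phi1 (e p + e q) _ t) -[RHS](phi1 (e p) _ (- t)) -[RHS](phi1 (e q) _ (- t)).
  rewrite [(e p + e q)^T]linearD /= mulmxDl !mulmxDr !eE.
  by congr phi; apply/matrixP => i j; rewrite !mxE; ring.
have -> : 2^-1 *: (x - x^T) =
    x + \sum_(pq : 'I_(1 + k) * 'I_(1 + k))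
      (- (2^-1 * x pq.1 pq.2)) *: (delta_mx pq.1 pq.2 + delta_mx pq.2 pq.1).
  rewrite -(pair_bigA _ (fun p q => (- (2^-1 * x p q)) *: (delta_mx p q + delta_mx q p))) /=.
  have xT : x^T = \sum_p \sum_q x p q *: delta_mx q p.
    rewrite [x in LHS]matrix_sum_delta linear_sum; apply: eq_bigr => p _.
    by rewrite linear_sum; apply: eq_bigr => q _; rewrite linearZ /= trmx_delta.
  have xE : x = \sum_p \sum_q x p q *: delta_mx p q by exact: matrix_sum_delta.
  have -> : \sum_p \sum_q (- (2^-1 * x p q)) *: (delta_mx p q + delta_mx q p) =
      - (2^-1 *: (x + x^T)).
    rewrite {2}xE xT -big_split /= scaler_sumr -sumrN; apply: eq_bigr => p _.
    rewrite -big_split /= scaler_sumr -sumrN; apply: eq_bigr => q _.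
    by rewrite -scalerDr scalerA scaleNr.
  by apply/matrixP => i j; rewrite !mxE; field.
by elim/big_rec: _ => [|pq y _ IH]; rewrite ?addr0 // [_ + y]addrC addrA phi2.
Qed.

(** By induction [phi] vanishes on every [1 (+) y]. These values are the slopes in the corner entry,
    so [phi] sees only the skew part. *)
Lemma semi_invariant_normal_eq0 k (phi : 'M[K]_k -> K) :
  semi_invariant phi -> plane_polynomial phi ->
  (forall i j (e : (i + j.*2)%N = k), phi (castmx (e, e) (normal_mx i j)) = 0) ->
  forall x, phi x = 0.
Proof.
elim: k phi => [|k IH] phi phiS phiP phi0 x.
  by rewrite -(phi0 0%N 0%N erefl) castmx_id; congr phi; apply/matrixP => -[].
have phi1 y : phi (block_mx (1%:M : 'M_1) 0 0 y) = 0.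
  apply: (IH (fun y => phi (block_mx (1%:M : 'M_1) 0 0 y))) => [||i j e].
  - exact: (@semi_invariant_block _ 1 k phi).
  - exact: (@plane_polynomial_block _ 1 k phi).
  case: k / e phi phi0 {phiS phiP IH x y} => phi phi0.
  by rewrite castmx_id; have := phi0 i.+1 j erefl; rewrite castmx_id.
rewrite (@semi_invariant_sym k phi) // => [|y t].
  apply: semi_invariant_skew => // [j e|].
    by have := phi0 0%N j e.
  by rewrite linearZ /= -scalerN linearB /= trmxK opprB.
by rewrite (@semi_invariant_affine _ k phi y t) // phi1 mulr0 addr0.
Qed.
End NormalForms.

(** * Relations as semi-invariants, and the pencil determinants *)

Section Relations.
Variable K : numFieldType.

Lemma mxeval_plane_polynomial m (f : {mpoly K[m * m]}) : plane_polynomial (mxeval f).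
Proof.
move=> x y z; exists (mmap (fun c => c%:P%:P) (fun k => (mxvec x 0 k)%:P%:P +
  (mxvec y 0 k)%:P%:P * 'X + ((mxvec z 0 k)%:P * 'X)%:P) f) => s t.
rewrite /mxeval mevalE /mmap horner_sum horner_sum; apply: eq_bigr => a _.
rewrite hornerM !hornerC hornerM hornerC /mmap1 !horner_prod; congr (_ * _).
apply: eq_bigr => k _; rewrite !horner_exp !hornerE !linearD !linearZ /= !mxE.
by rewrite [_ * s]mulrC [_ * t]mulrC.
Qed.

(** An orthogonal transposition moves the zero row and column to the last place, where the matrix
    comes from the smaller size. *)
Lemma restr_eq0_vanish n (f : {mpoly K[n.+1 * n.+1]}) i y :
  O_invariant f -> restr f = 0 -> row i y = 0 -> col i y = 0 -> mxeval f y = 0.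
Proof.
move=> f_inv f0 yr yc.
have tO : orthogonal_mx (tperm_mx i ord_max : 'M[K]_n.+1).
  by rewrite /orthogonal_mx tr_tperm_mx -perm_mxM tperm2 perm_mx1.
rewrite -(f_inv _ tO) conj_actE tr_tperm_mx -xrowE -xcolE.
set w := xcol _ _ _.
have wr j : w ord_max j = 0.
  by rewrite !mxE tpermR; move/rowP: yr => /(_ (tperm i ord_max j)); rewrite !mxE.
have wc j : w j ord_max = 0.
  by rewrite !mxE tpermR; move/colP: yc => /(_ (tperm i ord_max j)); rewrite !mxE.
pose e := (addn1 n); pose w1 : 'M_(n + 1) := castmx (esym e, esym e) w.
have max_shift (j : 'I_1) : cast_ord e (rshift n j) = ord_max.
  by apply: val_inj; rewrite /= ord1 addn0.
have -> : w = embed_mx (ulsubmx w1).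
  apply: (canRL (castmxKV _ _)); rewrite -/w1 -[LHS]submxK.
  congr block_mx; apply/matrixP => p q; rewrite !mxE castmxE /= ?esymK;
    by rewrite ?(max_shift p) ?(max_shift q).
by rewrite -restrE f0 /mxeval meval0.
Qed.

(** The matrices [g] obeying the law for all [x] are closed under products. They include the
    diagonal ones by the weight argument and the orthogonal ones since [(det g) ^ 2 = 1]. *)
Lemma mxeval_semi_invariant n (f : {mpoly K[n.+1 * n.+1]}) :
  f \is n.+1.-homog -> O_invariant f -> restr f = 0 -> semi_invariant (mxeval f).
Proof.
move=> f_homog f_inv f0 g.
apply: (@orthogonal_diagonal_generation K n.+1 (fun g => forall x,
  mxeval f (g^T *m x *m g) = (\det g) ^+ 2 * mxeval f x)) g => [A B fA fB x|d x|g gO x].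
- have -> : (A *m B)^T *m x *m (A *m B) = B^T *m (A^T *m x *m A) *m B.
    by rewrite trmx_mul !mulmxA.
  by rewrite fB fA det_mulmx; ring.
- by apply: torus_semi_invariant => // i y; apply: restr_eq0_vanish.
rewrite -conj_actE f_inv //.
have : \det (g^T *m g) = 1 by rewrite gO det1.
by rewrite det_mulmx det_tr -expr2 => ->; rewrite mul1r.
Qed.

(* [2 ^ m * det (s + c a)], for [s] and [a] the symmetric and skew parts of [x]. *)
Definition pencil_det m (c : K) : {mpoly K[m * m]} :=
  \det ((1 + c)%:MP *: coord_mx K m + (1 - c)%:MP *: (coord_mx K m)^T).

Lemma pencil_det_eval m c (x : 'M[K]_m) :
  mxeval (pencil_det m c) x = \det ((1 + c) *: x + (1 - c) *: x^T).
Proof.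
rewrite /mxeval /pencil_det -det_map_mx; congr (\det _).
rewrite map_mxD !map_mxZ -map_trmx coord_mx_eval /=.
by rewrite !mevalC.
Qed.

Lemma pencil_det_homog m c : pencil_det m c \is m.-homog.
Proof.
rewrite rpred_sum // => s _; rewrite rpredMsign -big_enum /=.
suff prod_homog e : \prod_(i <- e) ((1 + c)%:MP *: coord_mx K m +
    (1 - c)%:MP *: (coord_mx K m)^T) i (s i) \is (size e).-homog.
  by have := prod_homog (enum 'I_m); rewrite size_enum_ord.
elim: e => [|i e IH].
  by rewrite big_nil dhomog1.
rewrite big_cons -[size _]add1n; apply: dhomogM IH.
by rewrite !mxE rpredD // mul_mpolyC rpredZ // dhomogX /= mdeg1.
Qed.

Lemma pencil_det_invariant m c : O_invariant (pencil_det m c).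
Proof.
move=> g gO; apply: mxeval_inj => x; rewrite conj_actE !pencil_det_eval.
have -> : (1 + c) *: (g^T *m x *m g) + (1 - c) *: (g^T *m x *m g)^T =
    g^T *m ((1 + c) *: x + (1 - c) *: x^T) *m g.
  by rewrite !trmx_mul trmxK mulmxA mulmxDr mulmxDl -!scalemxAr -!scalemxAl.
by rewrite !det_mulmx mulrAC -det_mulmx gO det1 mul1r.
Qed.

Lemma restr_pencil_det n c : restr (pencil_det n.+1 c) = 0.
Proof.
apply: mxeval_inj => x; rewrite restrE pencil_det_eval [RHS]meval0.
(* The last row of the embedded pencil is zero, so the last basis vector lies in its left kernel. *)
apply/eqP/det0P; exists (delta_mx 0 ord_max).
  by apply/matrix0Pn; exists 0, ord_max; rewrite mxE !eqxx oner_eq0.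
have max_shift : cast_ord (esym (addn1 n)) ord_max = rshift n 0.
  by apply: val_inj; rewrite /= addn0.
apply/rowP => j; rewrite -rowE !mxE !castmxE /= max_shift.
have -> k : block_mx x 0 0 (0 : 'M_1) (rshift n 0) k = 0.
  by rewrite block_mxEv col_mxEd row_mx0 mxE.
have -> k : block_mx x 0 0 (0 : 'M_1) k (rshift n 0) = 0.
  by rewrite block_mxEh row_mxEr col_mx0 mxE.
by rewrite !mulr0 addr0.
Qed.

(** The determinant is multiplicative over diagonal blocks: each [1] contributes 2, each [J_2]
    contributes [det(2 c J_2) = 4 c ^ 2]. *)
Lemma pencil_det_normal c i j :
  \det ((1 + c) *: normal_mx K i j + (1 - c) *: (normal_mx K i j)^T) =
  2 ^+ (i + j.*2) * (c ^+ 2) ^+ j.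
Proof.
have block l k (A : 'M[K]_l) (B : 'M[K]_k) :
    \det ((1 + c) *: block_mx A 0 0 B + (1 - c) *: (block_mx A 0 0 B)^T) =
    \det ((1 + c) *: A + (1 - c) *: A^T) * \det ((1 + c) *: B + (1 - c) *: B^T).
  by rewrite tr_block_mx !scale_block_mx add_block_mx !trmx0 !scaler0 addr0 det_lblock.
elim: i => [|i IH] /=; last first.
  rewrite (block 1%N) IH addSn [2 ^+ _.+1]exprS -mulrA; congr (_ * _).
  by rewrite trmx1 -scalerDl detZ det1 mulr1 expr1; ring.
elim: j => [|j IH] /=; first by rewrite det_mx00 !expr0 mulr1.
rewrite (block 2) IH.
have -> : (1 + c) *: symplectic2 K + (1 - c) *: (symplectic2 K)^T = (2 * c) *: symplectic2 K.
  by apply/matrixP => p q; rewrite !mxE; ring.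
rewrite detZ (expand_det_row _ 0) !big_ord_recl big_ord0 /cofactor !det_mx11 !mxE /=.
by rewrite ?mulr1n ?mulr0n !exprS; ring.
Qed.
End Relations.

(** * Dimension count by interpolation at the normal forms *)

Section Dimension.
Variable K : numFieldType.

Definition relation n (f : {mpoly K[n.+1 * n.+1]}) := O_invariant f /\ restr f = 0.

Lemma relation_linear n a (f g : {mpoly K[n.+1 * n.+1]}) :
  relation f -> relation g -> relation (a *: f + g).
Proof.
move=> [f_inv f0] [g_inv g0]; split.
  by move=> h hO; rewrite /conj_act /mxsubst linearP /= [X in _ *: X]f_inv // [X in _ + X]g_inv.
by rewrite /restr /mxsubst linearP /= [X in _ *: X]f0 [X in _ + X]g0 scaler0 addr0.
Qed.

Lemma relation_sum n r (c : 'I_r -> K) (F : 'I_r -> {mpoly K[n.+1 * n.+1]}) :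
  (forall k, relation (F k)) -> relation (\sum_k c k *: F k).
Proof.
move=> relF; elim/big_rec: _ => [|k f _ relf]; last exact: relation_linear.
split; last by rewrite /restr /mxsubst linear0.
by move=> g _; rewrite /conj_act /mxsubst linear0.
Qed.

Lemma pencil_det_castmx m c i j (e : (i + j.*2)%N = m) :
  mxeval (pencil_det m c) (castmx (e, e) (normal_mx K i j)) = 2 ^+ m * (c ^+ 2) ^+ j.
Proof. by case: m / e; rewrite castmx_id pencil_det_eval pencil_det_normal. Qed.

(** Nodes are squares because the pencil determinant depends on [c] through [c ^ 2] at the normal
    forms; squares of distinct naturals are distinct. *)
Definition square_points r : 'rV[K]_r := \row_k k%:R ^+ 2.

Lemma Vandermonde_square_unit r : Vandermonde r (square_points r) \in unitmx.
Proof.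
rewrite unitmxE det_Vandermonde unitfE; apply/prodf_neq0 => i _; apply/prodf_neq0 => j ij.
by rewrite !mxE subr_eq0 eqrXn2 ?ler0n // eqr_nat gtn_eqF.
Qed.

Lemma normal_size m (j : 'I_m./2.+1) : (m - j.*2 + j.*2 = m)%N.
Proof. by rewrite subnK //; case: j => j /=; lia. Qed.

Definition normal_eval m (f : {mpoly K[m * m]}) : 'cV[K]_m./2.+1 :=
  \col_j mxeval f (castmx (normal_size j, normal_size j) (normal_mx K (m - j.*2) j)).

Lemma normal_eval_pencil m (c : 'cV[K]_m./2.+1) :
  normal_eval (\sum_k c k 0 *: pencil_det m k%:R) =
  2 ^+ m *: (Vandermonde _ (square_points _) *m c).
Proof.
apply/colP => j; rewrite !mxE /mxeval raddf_sum /= mulr_sumr; apply: eq_bigr => k _.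
rewrite mevalZ [X in _ * X]pencil_det_castmx !mxE; ring.
Qed.

Lemma relation_pencil n (f : {mpoly K[n.+1 * n.+1]}) : f \is n.+1.-homog ->
  relation f -> exists c : 'cV[K]_n.+1./2.+1, f = \sum_k c k 0 *: pencil_det n.+1 k%:R.
Proof.
move=> f_homog f_rel.
(* The solution of the interpolation problem: the combination with these coefficients agrees with
   [f] at every normal form. *)
pose c := invmx (Vandermonde _ (square_points _)) *m (2 ^- n.+1 *: normal_eval f).
exists c; set g := \sum_k _; apply/eqP; rewrite -subr_eq0 addrC -scaleN1r; apply/eqP.
have h_homog : -1 *: g + f \is n.+1.-homog.
  by rewrite rpredD // rpredZ // rpred_sum // => k _; rewrite rpredZ // pencil_det_homog.
have [h_inv h0] : relation (-1 *: g + f).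
  apply: relation_linear => //; apply: relation_sum => k; split.
    exact: pencil_det_invariant.
  exact: restr_pencil_det.
have h_semi := mxeval_semi_invariant h_homog h_inv h0.
apply: mxeval_inj => x; rewrite [RHS]meval0.
apply: (semi_invariant_normal_eq0 h_semi) x => [|i j e].
  exact: mxeval_plane_polynomial.
(* From [i + 2 j = n + 1], the index [j] is in range and determines [i], so [normal_eval] covers
   every normal form. *)
have jm : (j < n.+1./2.+1)%N by lia.
have iE : i = (n.+1 - (Ordinal jm).*2)%N by move=> /=; lia.
move: e; rewrite iE => e; rewrite (eq_irrelevance e (normal_size (Ordinal jm))).
have : normal_eval (-1 *: g + f) = 0.
  have -> : normal_eval (-1 *: g + f) = -1 *: normal_eval g + normal_eval f.
    by apply/colP => l; rewrite !mxE /mxeval mevalD mevalZ.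
  rewrite normal_eval_pencil /c mulKVmx ?Vandermonde_square_unit //.
  rewrite [2 ^+ _ *: _]scalerA divff ?scale1r.
    by rewrite scaleN1r addNr.
  by rewrite expf_neq0 ?pnatr_eq0.
by move/colP/(_ (Ordinal jm)); rewrite !mxE.
Qed.

(** Evaluating at the normal forms turns a linear dependency into a vector killed by the invertible
    Vandermonde matrix. *)
Lemma pencil_det_free n (c : 'cV[K]_n.+1./2.+1) :
  \sum_k c k 0 *: pencil_det n.+1 k%:R = 0 -> c = 0.
Proof.
move=> sum0; have := normal_eval_pencil c; rewrite sum0.
have -> : normal_eval (0 : {mpoly K[n.+1 * n.+1]}) = 0.
  by apply/colP => j; rewrite !mxE /mxeval meval0.
move/esym/eqP; rewrite scaler_eq0 expf_eq0 pnatr_eq0 /= => /eqP Wc.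
by rewrite -[c](mulKmx (Vandermonde_square_unit _)) Wc mulmx0.
Qed.

Definition pencil_hpoly n (k : nat) : hpolyfun K n.+1 n.+1 :=
  DHomog (pencil_det_homog n.+1 k%:R).

Lemma relation_space n : exists REL : {vspace hpolyfun K n.+1 n.+1},
  (forall f : hpolyfun K n.+1 n.+1,
     f \in REL <-> O_invariant (polyfun_of f) /\ restr (polyfun_of f) = 0) /\
  \dim REL = n.+1./2.+1.
Proof.
(* The candidate basis: pencil determinants for [c = 0, ..., (n + 1)./2]. *)
pose X := [tuple pencil_hpoly n k | k < n.+1./2.+1].
have valD (f g : hpolyfun K n.+1 n.+1) : polyfun_of (f + g) = polyfun_of f + polyfun_of g.
  by have := polyfun_of_is_linear 1 f g; rewrite !scale1r.
have val0 : polyfun_of (0 : hpolyfun K n.+1 n.+1) = 0.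
  by have := valD 0 0; rewrite addr0 => /eqP; rewrite -subr_eq subrr => /eqP.
have valZ a (f : hpolyfun K n.+1 n.+1) : polyfun_of (a *: f) = a *: polyfun_of f.
  by have := polyfun_of_is_linear a f 0; rewrite val0 !addr0.
have X_sum (c : 'I_n.+1./2.+1 -> K) : polyfun_of (\sum_k c k *: X`_k) =
    \sum_k c k *: pencil_det n.+1 k%:R.
  rewrite (big_morph _ valD val0); apply: eq_bigr => k _.
  by rewrite valZ -tnth_nth tnth_mktuple.
exists <<X>>%VS; split=> [f|]; last first.
  suff /eqP -> : free X by rewrite size_tuple.
  apply/freeP => c c0 i; have := X_sum c; rewrite c0 val0 => /esym sum0.
  have /colP/(_ i) : \col_k c k = 0; last by rewrite !mxE.
  by apply: pencil_det_free; rewrite -[RHS]sum0; apply: eq_bigr => k _; rewrite mxE.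
split=> [/coord_span ->|f_rel].
  rewrite X_sum; apply: relation_sum => k; split.
    exact: pencil_det_invariant.
  exact: restr_pencil_det.
have [c fE] := relation_pencil (dhomog_is_dhomog f) f_rel.
have -> : f = \sum_k c k 0 *: X`_k.
  apply: val_inj; rewrite [LHS]fE.
  by rewrite -[RHS]/(polyfun_of _) X_sum.
by apply: rpred_sum => k _; rewrite rpredZ // memv_span // mem_nth // size_tuple.
Qed.
End Dimension.

Theorem theorem1 (R : realType) (n : nat) (n_gt0 : (0 < n)%N) :
  exists REL : {vspace hpolyfun (complex R) n.+1 n.+1},
    (forall f : hpolyfun (complex R) n.+1 n.+1,
        f \in REL <-> O_invariant (polyfun_of f) /\ restr (polyfun_of f) = 0) /\
    \dim REL = (if odd n then (n + 3) %/ 2 else n %/ 2 + 1)%N.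
Proof.
have [REL [RELP dimREL]] := @relation_space (complex R) n.
exists REL; split; first exact: RELP.
(* The value [(n + 1)./2 + 1] is [n / 2 + 1] for even [n] and [(n + 3) / 2] for odd [n]. *)
by rewrite [LHS]dimREL; case: ifP => n_odd; lia.
Qed.
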